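(* Let $X = (X_n)_{n \geq 0}$ be a discrete-time homogeneous irreducible Markov chain on a finite state space $\mathcal{X}$ with transition matrix $P = (P_{i,j})_{i,j \in \mathcal{X}}$ and stationary distribution $\pi = (\pi_i)_{i \in \mathcal{X}}$. Assume that $X$ has constant row entropy, i.e. $H(P_{i,\cdot}) = H(P_{j,\cdot})$ for all $i,j \in \mathcal{X}$. Then for any $i,j \in \mathcal{X}$, $$H_{i,j} = \begin{cases} \mathbb{E}_i(\tau_j)\, H(X), & \text{for } i \neq j,\\ \mathbb{E}_i(\tau_i^+)\, H(X), & \text{for } i = j. \end{cases}$$
   Context: The convention $0\log 0 = 0$ is used throughout. One-step local entropy at state $i$: $H(P_{i,\cdot}) := -\sum_{j \in \mathcal{X}} P_{i,j}\log P_{i,j}$. Entropy rate of the chain: $H(X) := -\sum_{i,j\in\mathcal{X}} \pi_i P_{i,j}\log P_{i,j} = \sum_{i \in \mathcal{X}} \pi_i H(P_{i,\cdot})$. Entropy of Markov trajectories: for $i,j \in \mathcal{X}$ (possibly $i=j$), a trajectory $T_{i,j} = i x_1 x_2 \ldots x_{k-1} j$ from $i$ to $j$ is a finite path of $k \geq 1$ steps with initial state $i$, final state $j$, and no intervening state $x_1,\dots,x_{k-1}$ equal to $j$. Its probability is $p(T_{i,j}) := P_{i,x_1}P_{x_1,x_2}\cdots P_{x_{k-1},j}$ (which is $P_{i,j}$ when $k=1$). With $\mathcal{T}_{i,j}$ the set of all trajectories from $i$ to $j$, $$H_{i,j} := -\sum_{T_{i,j} \in \mathcal{T}_{i,j}}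 p(T_{i,j}) \log p(T_{i,j}).$$ Hitting and return times: $\tau_j := \inf\{n \geq 0 : X_n = j\}$ and $\tau_j^+ := \inf\{n \geq 1 : X_n = j\}$, with $\inf\emptyset = \infty$; $\mathbb{E}_i$ denotes expectation for the chain started at $X_0 = i$. *)

(* Defs.v *)
From HB Require Import structures.
From mathcomp Require Import all_boot all_order all_algebra.
From mathcomp Require Import all_classical all_reals all_analysis.

Set Implicit Arguments.
Unset Strict Implicit.
Unset Printing Implicit Defensive.

Import Order.TTheory GRing.Theory Num.Theory.
Import numFieldNormedType.Exports.

Local Open Scope classical_set_scope.
Local Open Scope ring_scope.

Section TransitionMatrix.
Context {R : realType} {S : finType}.
Implicit Types (P : S -> S -> R) (pi : S -> R) (i j : S).

Definition stochastic P : Prop :=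
  (forall i j, 0 <= P i j) /\ (forall i, \sum_(j : S) P i j = 1).

Fixpoint step_prob P (n : nat) i j : R :=
  if n is m.+1 then \sum_(k : S) P i k * step_prob P m k j else (i == j)%:R.

Definition irreducible P : Prop := forall i j, exists n, 0 < step_prob P n i j.

Definition stationary P pi : Prop :=
  [/\ forall i, 0 <= pi i, \sum_(i : S) pi i = 1
    & forall j, \sum_(i : S) pi i * P i j = pi j].

(* The product makes 0 * ln 0 = 0, here and below. *)
Definition row_entropy P i : R := - \sum_(j : S) P i j * ln (P i j).

Definition entropy_rate P pi : R :=
  - \sum_(i : S) \sum_(j : S) pi i * P i j * ln (P i j).

(* A trajectory i x_1 ... x_(k-1) j is the sequence of all its k+1 states. *)
Definition trajectories i j : set (seq S) :=
  [set t | exists2 s : seq S, j \notin s & t = i :: rcons s j].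

Definition path_prob P (t : seq S) : R :=
  \prod_(e <- zip t (behead t)) P e.1 e.2.

(* The sign is inside the sum: esum is a supremum of finite partial sums, so it
   is the unordered sum only for nonnegative terms. *)
Definition trajectory_entropy P i j : \bar R :=
  \esum_(t in trajectories i j) (- (path_prob P t * ln (path_prob P t)))%:E.

End TransitionMatrix.

Section Chain.
Context {d : measure_display} {Omega : measurableType d} {R : realType}
  {S : finType}.
Implicit Types (Q : probability Omega R) (X : nat -> Omega -> S).

Definition cond_prob Q (A B : set Omega) : R :=
  fine (Q (A `&` B)) / fine (Q B).

(* Each X n is measurable for the discrete sigma-algebra on S. *)
Definition markov_chain Q X (P : S -> S -> R) : Prop :=
  (forall n x, measurable [set w | X n w = x]) /\
  (forall n (x : nat -> S) (y : S),
     let past := [set w | forall m, (m <= n)%N -> X m w = x m] in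
     Q past != 0%E ->
     cond_prob Q [set w | X n.+1 w = y] past = P (x n) y).

Definition starts_at Q X (i : S) : Prop := Q [set w | X 0%N w = i] = 1%E.

(* ereal_inf set0 = +oo *)
Definition hitting_time X (j : S) (w : Omega) : \bar R :=
  ereal_inf [set n%:R%:E | n in [set n | X n w = j]].

Definition return_time X (j : S) (w : Omega) : \bar R :=
  ereal_inf [set n%:R%:E | n in [set n | (0 < n)%N /\ X n w = j]].

End Chain.

(* Main.v *)
(** Fix [j] and let [u n i], [q n i] and [H n i] be respectively the probability
    that the chain started at [i] avoids [j] at times [1..n], the probability
    that it first returns to [j] at time [n+1], and the contribution to the
    trajectory entropy of the trajectories with [n+1] steps. With
    [phi x = - x ln x], so that [phi (x y) = x phi y + y phi x], conditioning on
    the first step gives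
      [H (n+1) i = \sum_(k != j) (P i k * H n k + phi (P i k) * q n k)].
    As [q] telescopes to [1 - u], the partial sums [W N] of [H] and [V N] of [u]
    satisfy, when all rows have entropy [h],
      [W (N+1) i = h - \sum_(k != j) phi (P i k) * u N k
                   + \sum_(k != j) P i k * W N k],
      [V (N+1) i = 1 + \sum_(k != j) P i k * V N k].
    Hence [W N <= h V N], and [(1 - e) h V M <= W (N + M)] as soon as [u <= e]
    from rank [N] on. By the maximum principle and irreducibility [u] tends to
    [0], so the two series agree up to the factor [h]; the series of [u] is the
    expected return time. *)

Require Import Defs.
From HB Require Import structures.
From mathcomp Require Import all_boot all_order all_algebra.
From mathcomp Require Import all_classical all_reals all_analysis.
From mathcomp Require Import measurable_realfun ring.

Set Implicit Arguments.
Unset Strict Implicit.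
Unset Printing Implicit Defensive.

Import Order.TTheory GRing.Theory Num.Theory.
Import numFieldNormedType.Exports.

Local Open Scope classical_set_scope.
Local Open Scope ring_scope.

(** * The function [- x ln x] and its product rule *)

Section EntropyTerm.
Context {R : realType}.
Implicit Types x y : R.

Definition entropy_term x : R := - (x * ln x).

Lemma entropy_term_ge0 x : 0 <= x <= 1 -> 0 <= entropy_term x.
Proof.
move=> /andP[x0 x1]; rewrite /entropy_term -mulrN mulr_ge0// oppr_ge0.
exact: ln_le0.
Qed.

(** If a factor is zero, both sides vanish; otherwise [ln] turns the product into a sum. *)
Lemma entropy_termM x y : 0 <= x -> 0 <= y ->
  entropy_term (x * y) = x * entropy_term y + entropy_term x * y.
Proof.
rewrite le0r => /predU1P[->|x0].
  by rewrite /entropy_term !mul0r => _; ring.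
rewrite le0r => /predU1P[->|y0].
  by rewrite /entropy_term !(mul0r, mulr0); ring.
by rewrite /entropy_term lnM ?posrE//; ring.
Qed.

End EntropyTerm.

(** * First-step recursions for avoiding and hitting [j] *)

Section TabooRecursion.
Context {R : realType} {S : finType}.
Variables (P : S -> S -> R) (j : S).

(** This and the next two functions are [u], [q] and [H] of the overview. They are defined from [P]
    alone; sums over paths and events are matched to them later. *)
Fixpoint taboo_survival (n : nat) (i : S) : R :=
  if n is m.+1 then \sum_(k | k != j) P i k * taboo_survival m k else 1.

Fixpoint taboo_hit (n : nat) (i : S) : R :=
  if n is m.+1 then \sum_(k | k != j) P i k * taboo_hit m k else P i j.

Fixpoint taboo_entropy (n : nat) (i : S) : R :=
  if n is m.+1 then
    \sum_(k | k != j) (P i k * taboo_entropy m k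
                       + entropy_term (P i k) * taboo_hit m k)
  else entropy_term (P i j).

Definition survival_sum N i := \sum_(n < N) taboo_survival n i.
Definition entropy_sum N i := \sum_(n < N) taboo_entropy n i.

Hypothesis P_stochastic : stochastic P.

Lemma stochastic_ge0 i k : 0 <= P i k. Proof. exact: P_stochastic.1. Qed.

Lemma stochastic_sum i : \sum_k P i k = 1. Proof. exact: P_stochastic.2. Qed.

Lemma stochastic_le1 i k : P i k <= 1.
Proof.
rewrite -(stochastic_sum i) (bigD1 k)//= lerDl.
by apply: sumr_ge0 => l _; exact: stochastic_ge0.
Qed.

Lemma entropy_term_stochastic_ge0 i k : 0 <= entropy_term (P i k).
Proof. by rewrite entropy_term_ge0// stochastic_ge0 stochastic_le1. Qed.

Lemma taboo_survival_ge0 n i : 0 <= taboo_survival n i.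
Proof.
elim: n i => //= n IH i; apply: sumr_ge0 => k _.
by rewrite mulr_ge0// stochastic_ge0.
Qed.

Lemma taboo_hit_ge0 n i : 0 <= taboo_hit n i.
Proof.
elim: n i => [|n IH] i /=; first exact: stochastic_ge0.
by apply: sumr_ge0 => k _; rewrite mulr_ge0// stochastic_ge0.
Qed.

Lemma taboo_entropy_ge0 n i : 0 <= taboo_entropy n i.
Proof.
elim: n i => [|n IH] i /=; first exact: entropy_term_stochastic_ge0.
apply: sumr_ge0 => k _; rewrite addr_ge0 ?mulr_ge0 ?stochastic_ge0//.
  exact: entropy_term_stochastic_ge0.
exact: taboo_hit_ge0.
Qed.

(** Both sides obey the same linear first-step recursion; at [n = 0] the identity says that row [i]
    sums to one. *)
Lemma taboo_survivalB n i :
  taboo_survival n i - taboo_survival n.+1 i = taboo_hit n i.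
Proof.
elim: n i => [|n IH] i.
  rewrite /= -{1}(stochastic_sum i) (bigD1 j)//=.
  by rewrite [X in _ - X](eq_bigr (P i)) ?addrK// => k _; rewrite mulr1.
rewrite [taboo_survival n.+2 i]/= [taboo_survival n.+1 i]/= -sumrB /=.
by apply: eq_bigr => k _; rewrite -mulrBr -/(taboo_survival n.+1 k) IH.
Qed.

Lemma sum_taboo_hit N i : \sum_(n < N) taboo_hit n i = 1 - taboo_survival N i.
Proof.
elim: N => [|N IH]; first by rewrite big_ord0 subrr.
by rewrite big_ord_recr /= IH -taboo_survivalB /=; ring.
Qed.

Lemma taboo_survival_nonincreasing i :
  nonincreasing_seq (fun n => taboo_survival n i).
Proof.
apply/nonincreasing_seqP => n.
by rewrite -subr_ge0 taboo_survivalB taboo_hit_ge0.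
Qed.

Lemma survival_sumS N i :
  survival_sum N.+1 i = 1 + \sum_(k | k != j) P i k * survival_sum N k.
Proof.
rewrite /survival_sum big_ord_recl /=; congr (_ + _).
rewrite exchange_big /=; apply: eq_bigr => k _.
by rewrite mulr_sumr; apply: eq_bigr.
Qed.

Lemma entropy_sumS N i :
  entropy_sum N.+1 i = entropy_term (P i j) +
    \sum_(k | k != j) (P i k * entropy_sum N k
                       + entropy_term (P i k) * (1 - taboo_survival N k)).
Proof.
rewrite /entropy_sum big_ord_recl /=; congr (_ + _).
rewrite exchange_big /=; apply: eq_bigr => k _.
by rewrite big_split/= -!mulr_sumr sum_taboo_hit.
Qed.

Lemma survival_sum_ge0 N i : 0 <= survival_sum N i.
Proof. by apply: sumr_ge0 => n _; exact: taboo_survival_ge0. Qed.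

(** * Two-sided comparison of the partial sums *)

Section ConstantRowEntropy.
Variable h : R.
Hypothesis row_entropyE : forall i, row_entropy P i = h.

Lemma row_entropy_taboo i :
  h = entropy_term (P i j) + \sum_(k | k != j) entropy_term (P i k).
Proof. by rewrite -(row_entropyE i) /row_entropy -sumrN (bigD1 j). Qed.

Lemma constant_row_entropy_ge0 (i : S) : 0 <= h.
Proof.
rewrite (row_entropy_taboo i) addr_ge0 ?entropy_term_stochastic_ge0//.
by apply: sumr_ge0 => k _; exact: entropy_term_stochastic_ge0.
Qed.

(** Induction along the two recursions, with each factor [1 - taboo_survival N k] bounded by one. *)
Lemma entropy_sum_le N i : entropy_sum N i <= h * survival_sum N i.
Proof.
elim: N i => [|N IH] i.
  by rewrite /entropy_sum /survival_sum !big_ord0 mulr0.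
rewrite entropy_sumS survival_sumS mulrDr mulr1 {1}(row_entropy_taboo i).
rewrite -addrA lerD2l mulr_sumr -big_split/=; apply: ler_sum => k _.
rewrite [leLHS]addrC; apply: lerD.
  rewrite ler_piMr ?entropy_term_stochastic_ge0// gerBl.
  exact: taboo_survival_ge0.
by rewrite mulrCA ler_wpM2l ?stochastic_ge0.
Qed.

(** The shift by [N] makes every factor [1 - taboo_survival] met in the induction on [M] at least
    [1 - e]. *)
Lemma entropy_sum_ge e N : 0 <= e ->
    (forall k n, (N <= n)%N -> taboo_survival n k <= e) ->
  forall M i, (1 - e) * (h * survival_sum M i) <= entropy_sum (N + M) i.
Proof.
move=> e0 ue; elim=> [|M IH] i.
  rewrite /survival_sum big_ord0 !mulr0.
  by apply: sumr_ge0 => n _; exact: taboo_entropy_ge0.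
rewrite addnS entropy_sumS survival_sumS [h * _]mulrDr mulr1.
rewrite {1}(row_entropy_taboo i) -addrA mulrDr; apply: lerD.
  by rewrite ler_piMl ?entropy_term_stochastic_ge0// gerBl.
rewrite mulr_sumr -big_split/= mulr_sumr; apply: ler_sum => k _.
rewrite mulrDr addrC; apply: lerD.
  by rewrite 2!(mulrCA _ (P i k)) ler_wpM2l ?stochastic_ge0.
rewrite mulrC ler_wpM2l ?entropy_term_stochastic_ge0// lerB// ue//.
exact: leq_addr.
Qed.

End ConstantRowEntropy.

(** * Decay of the survival probabilities *)

Section Irreducible.
Hypothesis P_irreducible : irreducible P.

(* Maximum principle: a taboo-harmonic function attaining a positive maximum
   [m] at [i] equals [m] along every transition out of [i], none of which leads
   to [j]; hence [j] would not be reachable. *)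
Lemma taboo_harmonic_le0 (f : S -> R) :
  (forall i, f i = \sum_(k | k != j) P i k * f k) -> forall i, f i <= 0.
Proof.
move=> fE i0; rewrite leNgt; apply/negP => fi0.
have [i _ fmax] := @arg_maxP _ _ S i0 xpredT f isT.
have fle k : f k <= f i := fmax k isT.
have m0 : 0 < f i := lt_le_trans fi0 (fle i0).
have maxP l : f l = f i ->
    P l j = 0 /\ forall k, k != j -> P l k != 0 -> f k = f i.
  move=> fl.
  (* This is [f i] times the row sum at [l], minus the harmonic equation at [l]. All its terms are
     nonnegative, so each one vanishes. *)
  have : P l j * f i + \sum_(k | k != j) P l k * (f i - f k) = 0.
    under eq_bigr do rewrite mulrBr; rewrite sumrB -fE fl -mulr_suml addrA.
    have := stochastic_sum l; rewrite (bigD1 j)//= -mulrDl => ->.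
    by rewrite mul1r subrr.
  have t0 k : k != j -> 0 <= P l k * (f i - f k).
    by rewrite mulr_ge0 ?stochastic_ge0// subr_ge0 fle.
  move=> /eqP; rewrite paddr_eq0 ?sumr_ge0 ?mulr_ge0 ?stochastic_ge0 1?ltW//.
  rewrite mulf_eq0 (gt_eqF m0) orbF psumr_eq0// => /andP[/eqP-> /allP s0].
  split=> // k kj Plk; have := s0 k (mem_index_enum k).
  by rewrite kj mulf_eq0 (negbTE Plk)/= subr_eq0 => /eqP.
have step0 n l : f l = f i -> l != j -> step_prob P n l j = 0.
  elim: n l => [|n IH] l fl lj /=; first by rewrite (negbTE lj).
  have [Plj Plk] := maxP _ fl.
  apply: big1 => k _; have [->|kj] := eqVneq k j; first by rewrite Plj mul0r.
  have [->|Pk] := eqVneq (P l k) 0; first by rewrite mul0r.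
  by rewrite (IH k) ?mulr0 ?Plk.
(* The maximiser [i] may be [j] itself, so [step0] is applied to a successor [k] other than [j].
   Without such a successor, the harmonic equation gives [f i = 0]. *)
have [[k kj Pk]|noexit] := pselect (exists2 k, k != j & P i k != 0).
  have [n] := P_irreducible k j.
  by rewrite step0 ?ltxx//; exact: (maxP i erefl).2.
move: m0; rewrite fE big1 ?ltxx// => k kj.
have [->|Pk] := eqVneq (P i k) 0; first by rewrite mul0r.
by case: noexit; exists k.
Qed.

(** The monotone limit exists and inherits the recursion, a finite sum, so it is taboo-harmonic and
    the maximum principle applies. *)
Lemma taboo_survival_cvg0 i : taboo_survival n i @[n --> \oo] --> (0 : R).
Proof.
pose f k := limn (fun n => taboo_survival n k).
have uf k : taboo_survival n k @[n --> \oo] --> f k.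
  apply: nonincreasing_is_cvgn; first exact: taboo_survival_nonincreasing.
  by exists 0 => _ [n _ <-]; exact: taboo_survival_ge0.
suff f0 : f i = 0 by rewrite -f0.
apply/eqP; rewrite eq_le; apply/andP; split; last first.
  apply: limr_ge; first exact: uf.
  by apply: nearW => n; exact: taboo_survival_ge0.
apply: taboo_harmonic_le0 => k.
apply/cvg_lim => //; rewrite -cvg_shiftS /=.
apply: cvg_big; first exact: add_continuous.
by move=> l _; apply: cvgM; [exact: cvg_cst|exact: uf].
Qed.

(** Finiteness of [S] gives a common rank, and monotonicity keeps the bound beyond it. *)
Lemma taboo_survival_uniform_cvg0 (e : R) : 0 < e ->
  exists N, forall k n, (N <= n)%N -> taboo_survival n k <= e.
Proof.
move=> e0.
have /choice[N NP] : forall k, exists N, taboo_survival N k <= e.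
  move=> k; have /cvgrPdist_le/(_ e e0)[N _ /(_ N (leqnn N))] :=
    taboo_survival_cvg0 k.
  by rewrite /= sub0r normrN ger0_norm ?taboo_survival_ge0//; exists N.
exists (\max_k N k) => k n Nn; apply: le_trans (NP k).
apply: taboo_survival_nonincreasing.
by apply: leq_trans Nn; exact: leq_bigmax.
Qed.

End Irreducible.
End TabooRecursion.

(** * Passage to the limit *)

Section EntropySeries.
Context {R : realType} {S : finType}.
Variables (P : S -> S -> R) (j : S) (h : R).
Hypothesis P_stochastic : stochastic P.
Hypothesis P_irreducible : irreducible P.
Hypothesis row_entropyE : forall i, row_entropy P i = h.

Local Open Scope ereal_scope.

Lemma nneseries_taboo_entropy i :
  \sum_(n <oo) (taboo_entropy P j n i)%:E =
  h%:E * \sum_(n <oo) (taboo_survival P j n i)%:E.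
Proof.
have u0 n k : 0 <= (taboo_survival P j n k)%:E.
  by rewrite lee_fin taboo_survival_ge0.
have H0 n k : 0 <= (taboo_entropy P j n k)%:E.
  by rewrite lee_fin taboo_entropy_ge0.
have h0 : (0 <= h)%R.
  exact: (constant_row_entropy_ge0 j P_stochastic row_entropyE i).
have WE N : \sum_(0 <= n < N) (taboo_entropy P j n i)%:E =
    (entropy_sum P j N i)%:E.
  by rewrite sumEFin big_mkord.
have VE N : \sum_(0 <= n < N) (h%:E * (taboo_survival P j n i)%:E) =
    (h * survival_sum P j N i)%:E.
  under eq_bigr do rewrite -EFinM.
  by rewrite sumEFin -mulr_sumr big_mkord.
rewrite -nneseriesZl//; apply/eqP; rewrite eq_le; apply/andP; split.
  apply: lee_lim; [exact: is_cvg_nneseries| |].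
    by apply: is_cvg_nneseries => n _ _; rewrite mule_ge0.
  by apply: nearW => N; rewrite WE VE lee_fin; exact: entropy_sum_le.
(* Conversely, each partial sum on the right is bounded by the whole entropy series, up to an
   arbitrary [e]. *)
apply: lime_le.
  by apply: is_cvg_nneseries => n _ _; rewrite mule_ge0.
apply: nearW => M; rewrite VE; apply/lee_subgt0Pr => e e0.
set v := (h * _)%R; have v0 : (0 <= v)%R by rewrite mulr_ge0// survival_sum_ge0.
have v1 : (0 < v + 1)%R by rewrite ltr_wpDl.
(* Multiplied by [v], this tolerance costs at most [e]; the [+ 1] keeps the denominator positive
   when [v = 0]. *)
have d0 : (0 < e / (v + 1))%R by rewrite divr_gt0.
have [N uN] := taboo_survival_uniform_cvg0 j P_stochastic P_irreducible d0.
apply: (@le_trans _ _ (entropy_sum P j (N + M) i)%:E); last first.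
  by rewrite -WE; apply: nneseries_lim_ge.
rewrite -EFinB lee_fin.
apply: le_trans (entropy_sum_ge P_stochastic row_entropyE (ltW d0) uN M i).
rewrite -/v mulrBl mul1r lerB// -mulrA ler_piMr ?ltW// mulrC.
by rewrite ltr_pdivrMr// mul1r ltrDl.
Qed.

End EntropySeries.

(** * Sums over words avoiding [j] *)

Section TupleSums.
Context {R : nmodType} {S : finType}.
Variable j : S.

Lemma big_tuple0_notin (G : seq S -> R) :
  \sum_(t : 0.-tuple S | j \notin t) G t = G [::].
Proof. by rewrite (big_pred1 [tuple]) // => t; rewrite tuple0 /= eqxx. Qed.

(** Splitting off the first letter is the counterpart on words of conditioning on the first step. *)
Lemma big_tupleS_notin n (G : seq S -> R) :
  \sum_(t : n.+1.-tuple S | j \notin t) G t =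
  \sum_(k | k != j) \sum_(t : n.-tuple S | j \notin t) G (k :: t).
Proof.
pose cons_pair (p : S * n.-tuple S) := [tuple of p.1 :: p.2].
rewrite pair_big /= (reindex cons_pair) /=.
  by apply: eq_bigl => -[k t] /=; rewrite inE negb_or eq_sym.
exists (fun t : n.+1.-tuple S => (thead t, [tuple of behead t])).
  by move=> [k t] _ /=; rewrite theadE; congr pair; exact: val_inj.
by move=> t _ /=; rewrite [RHS]tuple_eta.
Qed.

End TupleSums.

(** * Expansion of the recursions over paths *)

Section PathProb.
Context {R : realType} {S : finType}.
Variables (P : S -> S -> R).
Implicit Types (i j k : S) (s t : seq S).

Lemma path_prob1 i : path_prob P [:: i] = 1.
Proof. by rewrite /path_prob big_nil. Qed.

Lemma path_prob_cons i k s :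
  path_prob P [:: i, k & s] = P i k * path_prob P (k :: s).
Proof. by rewrite /path_prob /= big_cons. Qed.

Lemma path_prob_rcons i s k :
  path_prob P (i :: rcons s k) = path_prob P (i :: s) * P (last i s) k.
Proof.
elim: s i => [|l s IH] i /=.
  by rewrite path_prob_cons !path_prob1 mul1r mulr1.
by rewrite !path_prob_cons IH mulrA.
Qed.

Lemma taboo_survivalE j n i :
  taboo_survival P j n i =
  \sum_(t : n.-tuple S | j \notin t) path_prob P (i :: t).
Proof.
elim: n i => [|n IH] i /=.
  by rewrite (big_tuple0_notin j (fun t => path_prob P (i :: t))) path_prob1.
rewrite (big_tupleS_notin j n (fun t => path_prob P (i :: t))).
apply: eq_bigr => k _; rewrite IH mulr_sumr.
by apply: eq_bigr => t _; rewrite path_prob_cons.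
Qed.

Lemma taboo_hitE j n i :
  taboo_hit P j n i =
  \sum_(t : n.-tuple S | j \notin t) path_prob P (i :: rcons t j).
Proof.
elim: n i => [|n IH] i /=.
  rewrite (big_tuple0_notin j (fun t => path_prob P (i :: rcons t j))) /=.
  by rewrite path_prob_cons path_prob1 mulr1.
rewrite (big_tupleS_notin j n (fun t => path_prob P (i :: rcons t j))).
apply: eq_bigr => k _; rewrite IH mulr_sumr.
by apply: eq_bigr => t _; rewrite /= path_prob_cons.
Qed.

Hypothesis P_stochastic : stochastic P.

Lemma path_prob_itv t : 0 <= path_prob P t <= 1.
Proof.
elim: t => [|i [|k s] IH]; rewrite ?path_prob1 ?lexx ?ler01//.
  by rewrite /path_prob big_nil lexx ler01.
case/andP: IH => s0 s1; rewrite path_prob_cons mulr_ge0 ?stochastic_ge0//=.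
by rewrite mulr_ile1 ?stochastic_ge0 ?stochastic_le1.
Qed.

(** The product rule of [entropy_term] splits off the first step; summing the remaining path
    probabilities produces the [taboo_hit] term. *)
Lemma taboo_entropyE j n i :
  taboo_entropy P j n i =
  \sum_(t : n.-tuple S | j \notin t) entropy_term (path_prob P (i :: rcons t j)).
Proof.
pose G k (t : seq S) := entropy_term (path_prob P (k :: rcons t j)).
elim: n i => [|n IH] i /=.
  rewrite (big_tuple0_notin j (G i)) /G /=.
  by rewrite path_prob_cons path_prob1 mulr1.
rewrite (big_tupleS_notin j n (G i)) /G.
apply: eq_bigr => k _; rewrite IH taboo_hitE !mulr_sumr -big_split /=.
apply: eq_bigr => t _; rewrite path_prob_cons entropy_termM ?stochastic_ge0//.
by case/andP: (path_prob_itv (k :: rcons t j)).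
Qed.

End PathProb.

Lemma fsbig_finpred (R : Type) (idx : R) (op : Monoid.com_law idx) (T : finType)
    (A : {pred T}) (F : T -> R) :
  \big[op/idx]_(x \in [set` A]) F x = \big[op/idx]_(x in A) F x.
Proof.
rewrite -big_enum [RHS]fsbig_seq ?enum_uniq//.
apply: eq_fsbigl; apply/seteqP.
by split => x /=; rewrite mem_enum.
Qed.

(** * Trajectory entropy graded by length *)

Section TrajectoryEntropy.
Context {R : realType} {S : finType}.
Variables (P : S -> S -> R) (j : S).
Hypothesis P_stochastic : stochastic P.

Lemma trajectories_bigcup i :
  trajectories i j = \bigcup_n
    [set i :: rcons (tval t) j |
      t in [set` [pred t : n.-tuple S | j \notin t]]].
Proof.
apply/seteqP; split=> [_ [s js ->]|_ [n _ [t /= jt <-]]]; last by exists t.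
by exists (size s) => //; exists (in_tuple s).
Qed.

Lemma trajectory_entropy_series i :
  trajectory_entropy P i j = (\sum_(n <oo) (taboo_entropy P j n i)%:E)%E.
Proof.
rewrite /trajectory_entropy trajectories_bigcup nneseries_sum_bigcup.
- apply: eq_eseriesr => n _; rewrite esum_image; last first.
    (* Reversal brings the final [j] to the front, where it can be cancelled. *)
    move=> t u _ _ [] /(congr1 rev); rewrite !rev_rcons => -[] /(can_inj revK).
    exact: val_inj.
  rewrite esum_fset; last 2 first.
  + exact: finite_finset.
  + by move=> t _; rewrite lee_fin entropy_term_ge0// path_prob_itv.
  by rewrite fsbig_finpred sumEFin taboo_entropyE.
(* Trajectories from different levels differ in length. *)
- apply/trivIsetP => n m _ _ nm; apply/seteqP; split=> // _ [[t _ <-]] [u _] [].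
  move=> /(congr1 size); rewrite !size_rcons !size_tuple => -[] mn.
  by rewrite mn eqxx in nm.
- by move=> t; rewrite lee_fin entropy_term_ge0// path_prob_itv.
Qed.

End TrajectoryEntropy.

(** * Expectation of a first time as a tail sum *)

Section FirstTime.
Context {R : realType}.
Local Open Scope ereal_scope.

(** The [n]-th term indicates that the first time exceeds [n]. If the least element is [k], exactly
    the terms [n < k] are one; if [D] is empty, all are one and both sides are infinite. *)
Lemma ereal_inf_nat_series (D : set nat) :
  ereal_inf [set n%:R%:E | n in D] =
  \sum_(n <oo) (`[< forall m, (m <= n)%N -> ~ D m >]%:R : R)%:E.
Proof.
have [[k Dk]|D0] := pselect (exists k, D k); last first.
  have noD m : ~ D m by move=> Dm; apply: D0; exists m.
  rewrite (_ : [set _ | _ in D] = set0) ?ereal_inf0; last first.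
    by apply/seteqP; split=> // x [n /noD].
  apply/esym/eq_infty => r.
  have [N rN] : exists N, (r <= N%:R)%R.
    exists (Num.bound `|r|); apply: (le_trans (ler_norm r)).
    by apply/ltW/archi_boundP.
  apply: (@le_trans _ _ N%:R%:E); first by rewrite lee_fin.
  apply: le_trans (@nneseries_lim_ge R _ xpredT 0 N _); last first.
    by move=> n _ _; rewrite lee_fin ler0n.
  rewrite sumEFin lee_fin (eq_bigr (fun=> 1%R)) ?big_const_nat ?subn0//.
    by rewrite iter_addr_0.
  by move=> n _; case: asboolP => // -[] m _; exact: noD.
have exD : exists k, `[< D k >] by exists k; exact/asboolP.
case: (ex_minnP exD) => {Dk}k /asboolP Dk kmin.
have {}kmin m : D m -> (k <= m)%N by move=> /asboolP; exact: kmin.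
rewrite (nneseries_split 0 k)// add0n [X in _ + X]eseries0 ?adde0; last first.
  by move=> n kn _; case: asboolP => // /(_ _ kn).
rewrite (eq_big_nat _ _ (F2 := fun=> 1)); last first.
  move=> n nk; case: asboolP => // -[] m mn /kmin km.
  by move: nk; rewrite ltnNge (leq_trans km mn).
rewrite sumEFin big_const_nat subn0 iter_addr_0.
apply/eqP; rewrite eq_le; apply/andP; split.
  by apply: ereal_inf_lbound; exists k.
by apply: le_ereal_inf_tmp => _ [n Dn <-]; rewrite lee_fin ler_nat kmin.
Qed.

Context {d : measure_display} {Omega : measurableType d}.

Lemma integral_first_time (Q : probability Omega R) (D : Omega -> set nat) :
    (forall n, measurable [set w | D w n]) ->
  \int[Q]_w ereal_inf [set n%:R%:E | n in D w] =
  \sum_(n <oo) Q [set w | forall m, (m <= n)%N -> ~ D w m].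
Proof.
move=> mD.
pose A n := [set w | forall m, (m <= n)%N -> ~ D w m].
have mA n : measurable (A n).
  rewrite (_ : A n = \bigcap_(m in [set m | (m <= n)%N]) ~` [set w | D w m]) //.
  by apply: bigcap_measurable => [|m _]; [exists 0%N|exact: measurableC].
rewrite (eq_integral (fun w => \sum_(n <oo) (\1_(A n) w)%:E)); last first.
  by move=> w _; exact: ereal_inf_nat_series.
rewrite integral_nneseries//.
  by apply: eq_eseriesr => n _; rewrite integral_indic// setIT.
by move=> n; apply/measurable_EFinP; exact: measurable_indic.
Qed.

(** Allows the almost sure initial condition to be added to an event. *)
Lemma measure_setI_full (Q : probability Omega R) (A B : set Omega) :
  measurable A -> measurable B -> Q B = 1 -> Q (A `&` B) = Q A.
Proof.
move=> mA mB QB; rewrite [RHS](measureDI Q mA mB).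
rewrite [X in _ = X + _](_ : _ = 0) ?add0e//.
apply: (@subset_measure0 _ _ _ Q _ (~` B)) => //.
- exact: measurableD.
- exact: measurableC.
- by apply: (eq_trans (probability_setC Q mB)); rewrite QB subee.
Qed.

End FirstTime.

(** * Law of finite paths and expected times *)

Section ChainLaw.
Context {d : measure_display} {Omega : measurableType d} {R : realType}
  {S : finType}.
Variables (Q : probability Omega R) (X : nat -> Omega -> S) (P : S -> S -> R).
Variables (i j : S).
Hypothesis X_markov : markov_chain Q X P.
Hypothesis X_start : starts_at Q X i.

(** [s] lists the states at times 1 to [size s]; index 0 reads the start [i]. *)
Definition path_event (s : seq S) : set Omega :=
  [set w | forall m, (m <= size s)%N -> X m w = nth i (i :: s) m].

Lemma measurable_state n x : measurable [set w | X n w = x].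
Proof. exact: X_markov.1. Qed.

Lemma measurable_path_event s : measurable (path_event s).
Proof.
rewrite (_ : path_event s = \bigcap_(m in [set m | (m <= size s)%N])
  [set w | X m w = nth i (i :: s) m])//.
apply: bigcap_measurable => [|m _]; first by exists 0%N.
exact: measurable_state.
Qed.

Lemma path_event_rcons s y : path_event (rcons s y) =
  [set w | X (size s).+1 w = y] `&` path_event s.
Proof.
have nthE m : (m <= size s)%N ->
    nth i (i :: rcons s y) m = nth i (i :: s) m.
  by move=> ms; rewrite -rcons_cons nth_rcons /= ltnS ms.
apply/seteqP; split=> w; rewrite /path_event /= size_rcons.
  move=> ws; split=> [|m ms]; last by rewrite ws ?nthE// (leq_trans ms).
  by rewrite ws//= nth_rcons ltnn eqxx.
move=> [wy ws] m; rewrite leq_eqVlt => /predU1P[->|ms].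
  by rewrite wy /= nth_rcons ltnn eqxx.
by rewrite nthE// ws.
Qed.

Lemma prob_path_event s : Q (path_event s) = (path_prob P (i :: s))%:E.
Proof.
(* The Markov property conditions on the whole past, so the path is extended at its end. *)
elim/last_ind: s => [|s y IH].
  rewrite path_prob1 -X_start; congr (Q _).
  by apply/seteqP; split=> w /= => [/(_ 0%N)->//|w0 [|//] _].
rewrite path_event_rcons path_prob_rcons.
have mA := measurable_state (size s).+1 y; have mB := measurable_path_event s.
(* The Markov property says nothing about a null past; there both sides are zero. *)
have [B0|B0] := eqVneq (Q (path_event s)) 0%E.
  have -> : path_prob P (i :: s) = 0 by apply: EFin_inj; rewrite -IH.
  rewrite mul0r; apply: subset_measure0 B0 => //; exact: measurableI.
have := X_markov.2 (size s) (nth i (i :: s)) y B0.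
rewrite (_ : nth i (i :: s) (size s) = last i s); last first.
  by rewrite -[RHS]/(last i (i :: s)) -nth_last.
rewrite /cond_prob -/(path_event s) IH /= => /eqP.
have p0 : path_prob P (i :: s) != 0 by apply: contra B0; rewrite IH => /eqP ->.
rewrite eq_sym -(can2_eq (mulfK p0) (mulfVK p0)) => /eqP PE.
rewrite mulrC PE fineK// fin_num_measure//; exact: measurableI.
Qed.

(** [j] is excluded only from time 1 on, so the event serves both hitting and return times. *)
Definition survival_event n : set Omega :=
  [set w | X 0%N w = i /\ forall m, (m < n)%N -> X m.+1 w <> j].

Lemma survival_event_bigcup n : survival_event n =
  \bigcup_(t in [set` [pred t : n.-tuple S | j \notin t]]) path_event t.
Proof.
apply/seteqP; split=> w /=.
  move=> [w0 wj]; exists [tuple of mkseq (fun m => X m.+1 w) n] => /=.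
    by apply/mapP => -[m]; rewrite mem_iota => /= mn /esym; exact: wj.
  by move=> [//|m]; rewrite size_mkseq => mn /=; rewrite nth_mkseq.
move=> [t /= jt wt]; split=> [|m mn]; first exact: (wt 0%N).
rewrite wt ?size_tuple//= => tj.
by case/negP: jt; rewrite -tj; apply: mem_nth; rewrite size_tuple.
Qed.

Lemma prob_survival_event n :
  Q (survival_event n) = (taboo_survival P j n i)%:E.
Proof.
rewrite survival_event_bigcup measure_fin_bigcup; last 3 first.
- exact: finite_finset.
(* The path events are disjoint, since an outcome determines its word of states. *)
- move=> t u _ _ [w [wt wu]]; apply/val_inj/(@eq_from_nth _ i).
    by rewrite !size_tuple.
  move=> m mt; have := wt m.+1 mt; rewrite /= => <-.
  by apply: (wu m.+1); move: mt; rewrite !size_tuple.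
- by move=> t _; exact: measurable_path_event.
rewrite fsbig_finpred taboo_survivalE -sumEFin.
by apply: eq_bigr => t _; exact: prob_path_event.
Qed.

Local Open Scope ereal_scope.

(** Since [i != j], avoiding [j] at time 0 is automatic on the initial event, so no visit up to time
    [n] means survival up to [n]. *)
Lemma expected_hitting_time : i != j ->
  \int[Q]_w hitting_time X j w = \sum_(n <oo) (taboo_survival P j n i)%:E.
Proof.
move=> ij; rewrite /hitting_time integral_first_time; last first.
  by move=> n; exact: measurable_state.
apply: eq_eseriesr => n _.
rewrite -(measure_setI_full _ (measurable_state 0 i) X_start); last first.
  rewrite (_ : mkset _ = \bigcap_(m in [set m | (m <= n)%N])
    ~` [set w | X m w = j]) //.
  apply: bigcap_measurable => [|m _]; first by exists 0%N.
  exact/measurableC/measurable_state.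
rewrite -prob_survival_event; congr (Q _).
apply/seteqP; split=> w /= [wj w0]; split=> //.
  by move=> m mn; exact: wj.
move=> [_|m mn]; last exact: w0.
by rewrite wj => /eqP; exact/negP.
Qed.

Lemma expected_return_time :
  \int[Q]_w return_time X j w = \sum_(n <oo) (taboo_survival P j n i)%:E.
Proof.
have mD n : measurable [set w | (0 < n)%N /\ X n w = j].
  case: n => [|n].
    by rewrite (_ : mkset _ = set0)//; apply/seteqP; split=> // w [].
  rewrite (_ : mkset _ = [set w | X n.+1 w = j]); first exact: measurable_state.
  by apply/seteqP; split=> w //= [].
rewrite /return_time.
rewrite (@integral_first_time _ _ _ Q (fun w n => (0 < n)%N /\ X n w = j))//.
apply: eq_eseriesr => n _.
rewrite -(measure_setI_full _ (measurable_state 0 i) X_start); last first.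
  rewrite (_ : mkset _ = \bigcap_(m in [set m | (m <= n)%N])
    ~` [set w | (0 < m)%N /\ X m w = j]) //.
  apply: bigcap_measurable => [|m _]; first by exists 0%N.
  exact: measurableC.
rewrite -prob_survival_event; congr (Q _).
apply/seteqP; split=> w /= [wj w0]; split=> //.
  by move=> m mn wm; exact: (wj m.+1).
by move=> [_ []//|m mn [_]]; exact: w0.
Qed.

End ChainLaw.

Theorem theorem1p1 (R : realType) (S : finType) (P : S -> S -> R) (pi : S -> R)
    (d : measure_display) (Omega : measurableType d)
    (Pr : S -> probability Omega R) (X : nat -> Omega -> S)
    (P_stochastic : stochastic P)
    (P_irreducible : irreducible P)
    (pi_stationary : stationary P pi)
    (X_markov : forall i : S, markov_chain (Pr i) X P)
    (X_start : forall i : S, starts_at (Pr i) X i)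
    (constant_row_entropy : forall i j : S, row_entropy P i = row_entropy P j)
    (i j : S) :
  trajectory_entropy P i j =
    ((if i != j then \int[Pr i]_w hitting_time X j w
      else \int[Pr i]_w return_time X i w) * (entropy_rate P pi)%:E)%E.
Proof.
(* The entropy rate is the [pi]-average of equal row entropies, and [pi] sums to one. *)
have rateE k : row_entropy P k = entropy_rate P pi.
  case: pi_stationary => _ pi1 _; rewrite /entropy_rate -sumrN.
  rewrite -[LHS]mul1r -pi1 mulr_suml; apply: eq_bigr => l _.
  rewrite (constant_row_entropy k l) /row_entropy mulrN mulr_sumr.
  by congr (- _); apply: eq_bigr => m _; rewrite mulrA.
rewrite trajectory_entropy_series//.
rewrite (nneseries_taboo_entropy j P_stochastic P_irreducible rateE) muleC.
congr (_ * _)%E; have [<-|ij] := eqVneq i j.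
  by rewrite (expected_return_time i (X_markov i) (X_start i)).
by rewrite (expected_hitting_time (X_markov i) (X_start i)).
Qed.
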